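(* Let $p\in(0,1)$ and suppose a deck of $n$ cards is shuffled once by the asymmetric single-shelf shuffle with parameter $p$. Let $m_{i,j}$ be the probability that card $i$ lands in position $j$. Then $$m_{i,j}=p^{j}(1-p)^{i-j}\binom{i-1}{j-1}+p^{\,i-1-(n-j)}(1-p)^{n-j+1}\binom{i-1}{n-j}$$ for $1\le i\le n-1$ and $1\le j\le n$, and for $i=n$ $$m_{n,j}=p^{j-1}(1-p)^{n-j}\binom{n-1}{j-1},\qquad 1\le j\le n.$$
   Context: Asymmetric single-shelf shuffle with parameter $p\in(0,1)$: an ordered deck of $n$ cards labelled $1,\dots,n$ (card $1$ on top, card $n$ at the bottom) is given. Cards are drawn one by one from the bottom of the deck (so in the order $n,n-1,\dots,1$) and put on an initially empty pile; each drawn card is placed, independently, at the top of the pile with probability $p$ and at the bottom of the pile with probability $1-p$. The final pile is the shuffled deck; positions are numbered $1,\dots,n$ from the top. Convention: $\binom{0}{0}=1$ and $\binom{a}{b}=0$ for integers $b>a\ge 0$ (exponents of $p$ and $1-p$ may be negative only where the binomial coefficient vanishes). *)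

(* Defs.v *)
From HB Require Import structures.
From mathcomp Require Export all_boot all_order all_algebra.
From mathcomp Require Export all_classical all_reals all_analysis.

Set Implicit Arguments.
Unset Strict Implicit.
Unset Printing Implicit Defensive.

Import Order.TTheory GRing.Theory Num.Theory.
Local Open Scope classical_set_scope.
Local Open Scope ring_scope.
Local Open Scope ereal_scope.

(* Mutual independence of the finitely many Boolean random variables [X k],
   [k] in [s].  Taking [B k = setT] for some of the [k] gives the product rule
   for every subfamily. *)
Definition mutually_independent (d : measure_display) (T : measurableType d)
    (R : realType) (P : probability T R) (s : seq nat)
    (X : nat -> {RV P >-> bool}) : Prop :=
  forall B : nat -> set bool,
    P (\bigcap_(k in [set` s]) (X k @^-1` B k)) =
    \prod_(k <- undup s) P (X k @^-1` B k).

(* Decks and piles are listed from top to bottom. *)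
Definition ordered_deck (n : nat) : seq nat := iota 1 n.

Definition place (top : nat -> bool) (pile : seq nat) (c : nat) : seq nat :=
  if top c then c :: pile else rcons pile c.

(* [top c] tells whether card [c] is placed at the top of the pile. *)
Definition shelf_shuffle (n : nat) (top : nat -> bool) : seq nat :=
  foldl (place top) [::] (rev (ordered_deck n)).

(* Positions are numbered from 1, at the top. *)
Definition position (i : nat) (deck : seq nat) : nat := (index i deck).+1.

(* The law of the random placements: cards [1, ..., n] are placed
   independently, each at the top with probability [p]. *)
Definition shelf_placements (d : measure_display) (T : measurableType d)
    (R : realType) (P : probability T R) (p : R) (n : nat)
    (X : nat -> {RV P >-> bool}) : Prop :=
  mutually_independent (ordered_deck n) X /\
  (forall c, c \in ordered_deck n -> P [set w | X c w] = p%:E).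

Definition landing_prob (d : measure_display) (T : measurableType d)
    (R : realType) (P : probability T R) (n : nat)
    (X : nat -> {RV P >-> bool}) (i j : nat) : \bar R :=
  P [set w | position i (shelf_shuffle n (fun c => X c w)) = j].

(* Main.v *)
Require Import Defs.
From mathcomp Require Import all_boot all_order all_algebra.
From mathcomp Require Import all_classical all_reals all_analysis.
From mathcomp Require Import ring zify.

(** Card [i] enters the pile at the top, in position 1, or at the bottom, in
    position [n - i + 1]; afterwards it moves down by one exactly when one of
    the cards [i - 1, ..., 1] is placed at the top.  The number of those cards
    is binomial and independent of the placement of [i].  For [i = n] the two
    entry positions coincide. *)

Import Order.TTheory GRing.Theory Num.Theory.
Local Open Scope classical_set_scope.
Local Open Scope ring_scope.

(** * Position of a card when all placements are fixed *)

Lemma index_foldl_place (top : nat -> bool) (i : nat) (s pile : seq nat) :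
  i \in pile -> i \notin s ->
  index i (foldl (place top) pile s) = (index i pile + count top s)%N.
Proof.
elim: s pile => [|c s IHs] pile ipile /=; first by rewrite addn0.
rewrite inE negb_or => /andP[neq_ic nis].
rewrite IHs //; rewrite /place; case: (top c).
- by rewrite /= eq_sym (negbTE neq_ic) addnA addn1.
- by rewrite -cats1 index_cat ipile add0n.
- by rewrite inE ipile orbT.
- by rewrite mem_rcons inE ipile orbT.
Qed.

(** Used to identify the pile met by card [i]: it holds exactly the cards [i + 1, ..., n], which
    gives its size [n - i] and the absence of [i]. *)
Lemma perm_foldl_place (top : nat -> bool) (s pile : seq nat) :
  perm_eq (foldl (place top) pile s) (s ++ pile).
Proof.
elim: s pile => [|c s IHs] pile //=.
apply: perm_trans (IHs _) _.
rewrite -[X in perm_eq _ X]cat1s perm_sym perm_catCA perm_cat2l cat1s perm_sym.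
by rewrite /place; case: (top c); rewrite // perm_rcons.
Qed.

Lemma position_shelf_shuffle (n i : nat) (top : nat -> bool) :
  (1 <= i <= n)%N ->
  position i (shelf_shuffle n top) =
  (((if top i then 0 else n - i) + count top (iota 1 (i - 1))).+1)%N.
Proof.
move=> /andP[i_gt0 le_in]; congr S.
have -> : shelf_shuffle n top =
    foldl (place top) [::] (rev (iota i.+1 (n - i)) ++ i :: rev (iota 1 (i - 1))).
  congr foldl; rewrite /ordered_deck.
  (* The deck is cut into the cards below [i], the card [i] and the cards above [i]; reversal makes
     the larger cards come first. *)
  rewrite [in LHS](_ : n = (i - 1 + (1 + (n - i)))%N); last lia.
  rewrite !iotaD !rev_cat /= -catA.
  by rewrite (_ : (1 + (i - 1))%N = i) ?addn1; last lia.
rewrite foldl_cat /=.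
set pile := foldl _ _ (rev (iota i.+1 _)).
have pile_perm : perm_eq pile (iota i.+1 (n - i)).
  apply: perm_trans (perm_foldl_place _ _ _) _.
  by rewrite cats0 perm_rev.
have ipile : i \notin pile.
  by rewrite (perm_mem pile_perm) mem_iota ltnn.
have size_pile : size pile = (n - i)%N.
  by rewrite (perm_size pile_perm) size_iota.
rewrite index_foldl_place.
- rewrite count_rev; congr addn.
  rewrite /place; case: (top i); first by rewrite /= eqxx.
  by rewrite -cats1 index_cat (negbTE ipile) /= eqxx addn0 size_pile.
- by rewrite /place; case: (top i); rewrite ?mem_rcons inE eqxx.
- by rewrite mem_rev mem_iota; lia.
Qed.

(** * Joint law of the number of top placements and of other placements *)

Section PlacementCounts.
Set Implicit Arguments.
Unset Strict Implicit.
Variables (R : realType) (d : measure_display) (T : measurableType d).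
Variables (P : probability T R) (p : R) (X : nat -> {RV P >-> bool}).
Variable s : seq nat.
Hypothesis indep : mutually_independent s X.
Hypothesis law : forall c, c \in s -> P [set w | X c w] = p%:E.

Lemma measurable_placement (c : nat) (B : set bool) :
  measurable (X c @^-1` B).
Proof.
by rewrite -[_ @^-1` _]setTI; apply: (@measurable_funPT _ _ _ _ (X c)).
Qed.

Lemma prob_placement (c : nat) (b : bool) :
  c \in s -> P (X c @^-1` [set b]) = (if b then p else 1 - p)%:E.
Proof.
move=> cs.
have top : X c @^-1` [set true] = [set w | X c w] by [].
case: b; first by rewrite top law.
have -> : X c @^-1` [set false] = ~` (X c @^-1` [set true]).
  by apply/seteqP; split => w /=; case: (X c w).
by rewrite probability_setC ?top ?law //; exact: measurable_placement.
Qed.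

Definition top_count (t : seq nat) (k : nat) : set T :=
  [set w | count (fun c => X c w) t = k].

Lemma top_count_cons (c : nat) (t : seq nat) (k : nat) :
  top_count (c :: t) k =
  (X c @^-1` [set false] `&` top_count t k) `|`
  (if k is k'.+1 then X c @^-1` [set true] `&` top_count t k' else set0).
Proof.
rewrite /top_count; apply/seteqP; case: k => [|k]; split=> w /=;
  case: (X c w) => //=; rewrite ?add0n ?add1n.
- by left.
- by case=> // -[].
- by case=> [[_ ->]|[]].
- by case=> eq_k; right.
- by left.
- by case=> -[] // _ ->.
- by case=> [[_ ->]|[]].
Qed.

Lemma measurable_top_count (t : seq nat) (k : nat) : measurable (top_count t k).
Proof.
elim: t k => [|c t IHt] k.
  case: k => [|k].
    by rewrite (_ : top_count _ _ = setT) //; apply/seteqP; split.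
  by rewrite (_ : top_count _ _ = set0) //; apply/seteqP; split.
rewrite top_count_cons; apply: measurableU.
  by apply: measurableI => //; exact: measurable_placement.
case: k => [|k] //.
by apply: measurableI => //; exact: measurable_placement.
Qed.

(** The truncated exponent [m - k] is harmless: for [k > m] the binomial coefficient is 0. *)
Definition binomial_weight (m k : nat) : R :=
  p ^+ k * (1 - p) ^+ (m - k) * 'C(m, k)%:R.

(** Pascal's rule, in the form matching [top_count_cons]: the extra card goes to the bottom or to
    the top. *)
Lemma binomial_weightS (m k : nat) :
  binomial_weight m.+1 k = binomial_weight m k * (1 - p) +
    (if k is k'.+1 then binomial_weight m k' * p else 0).
Proof.
rewrite /binomial_weight; case: k => [|k].
  by rewrite !subn0 !bin0 exprSr; ring.
rewrite subSS binS natrD exprS.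
(* For [k >= m] the exponents [m - k] and [m - k.+1] are both truncated to 0, so the factor [1 - p]
   is not absorbed; but then ['C(m, k.+1)] vanishes. *)
case: (ltnP k m) => [lt_km|le_mk].
  by rewrite (_ : (m - k)%N = (m - k.+1).+1) ?exprS; [ring | lia].
by rewrite (@bin_small m k.+1) //; ring.
Qed.

(** Independence speaks only of intersections of placement events, so the induction on [t] carries
    an arbitrary such intersection along. Each card peeled off [t] becomes a constraint in [B], and
    the empty [t] is independence itself. *)
Lemma prob_top_count_bigcap (t : seq nat) (B : nat -> set bool) (k : nat) :
  uniq t -> {subset t <= s} -> {in t, forall c, B c = setT} ->
  P (top_count t k `&` \bigcap_(c in [set` s]) (X c @^-1` B c)) =
  ((binomial_weight (size t) k)%:E *
   \prod_(c <- undup s) P (X c @^-1` B c))%E.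
Proof.
elim: t B k => [|c t IHt] B k /=.
  move=> _ _ _; case: k => [|k].
    rewrite (_ : top_count _ _ = setT) ?setTI ?indep.
      by rewrite /binomial_weight bin0 !expr0 !mul1r mul1e.
    by apply/seteqP; split.
  rewrite (_ : top_count _ _ = set0) ?set0I ?measure0.
    by rewrite /binomial_weight bin_small // mulr0 mul0e.
  by apply/seteqP; split.
move=> /andP[ct uniq_t] sub_ct_s BT.
have cs : c \in s by apply: sub_ct_s; rewrite mem_head.
(* [Bc b] adds to [B] the constraint that card [c] has placement [b]; since [c] is not in [t], it
   remains trivial on [t]. *)
pose Bc b c' := if c' == c then [set b] else B c'.
pose rest := (\prod_(c' <- undup s | c' != c) P (X c' @^-1` B c'))%E.
(* Finiteness allows distributing over the sum in the extended reals. *)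
have rest_fin : rest \is a fin_num.
  by apply: prode_fin_num => c' _; apply: fin_num_measure; exact: measurable_placement.
have prodBc b : (\prod_(c' <- undup s) P (X c' @^-1` Bc b c') =
    (if b then p else 1 - p)%:E * rest)%E.
  rewrite (bigD1_seq c) ?mem_undup ?undup_uniq //= /Bc eqxx prob_placement //.
  by congr mule; apply: eq_bigr => c' /negbTE ->.
have prodB : (\prod_(c' <- undup s) P (X c' @^-1` B c') = rest)%E.
  rewrite (bigD1_seq c) ?mem_undup ?undup_uniq //= BT ?mem_head //.
  by rewrite preimage_setT probability_setT mul1e.
have IH b k' : P (top_count t k' `&`
      \bigcap_(c' in [set` s]) (X c' @^-1` Bc b c')) =
    ((binomial_weight (size t) k' * (if b then p else 1 - p))%:E * rest)%E.
  rewrite IHt //; first by rewrite prodBc muleA.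
  - by move=> c' c't; apply: sub_ct_s; rewrite inE c't orbT.
  - move=> c' c't; rewrite /Bc; case: eqP => [cc'|_].
      by rewrite -cc' c't in ct.
    by apply: BT; rewrite inE c't orbT.
have capBc b : \bigcap_(c' in [set` s]) (X c' @^-1` Bc b c') =
    X c @^-1` [set b] `&` \bigcap_(c' in [set` s]) (X c' @^-1` B c').
  rewrite /Bc; apply/seteqP; split=> w /=.
    move=> capw; split; first by have := capw c cs; rewrite eqxx.
    move=> c' c's; have := capw c' c's; case: eqP => // -> _.
    by rewrite BT ?mem_head.
  by case=> Xcw capw c' c's; case: eqP => [->|_] //; exact: capw.
have meas b k' : measurable (top_count t k' `&`
    \bigcap_(c' in [set` s]) (X c' @^-1` Bc b c')).
  apply: measurableI; first exact: measurable_top_count.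
  apply: bigcap_measurableType => c' _; exact: measurable_placement.
rewrite top_count_cons setIUl prodB binomial_weightS EFinD muleDl //.
rewrite -(IH false) capBc setIA (setIC (top_count t k)).
case: k => [|k]; first by rewrite set0I setU0 mul0e adde0.
rewrite -(IH true) capBc setIA (setIC (top_count t k)).
rewrite measureU //.
- have := meas false k.+1.
  by rewrite capBc setIA (setIC (top_count t k.+1)).
- have := meas true k.
  by rewrite capBc setIA (setIC (top_count t k)).
- by apply/seteqP; split=> w //= -[[[-> _] _] [[]]].
Qed.

Lemma prob_top_count (t : seq nat) (k : nat) :
  uniq t -> {subset t <= s} ->
  P (top_count t k) = (binomial_weight (size t) k)%:E.
Proof.
move=> uniq_t sub_ts.
have := @prob_top_count_bigcap t (fun=> setT) k uniq_t sub_ts (fun _ _ => erefl).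
rewrite bigcapT ?setIT => [->|//].
by rewrite big1 ?mule1 // => c _; rewrite preimage_setT probability_setT.
Qed.

(** Constraining [c] alone leaves one nontrivial factor in the product over the deck. *)
Lemma prob_top_count_placement (t : seq nat) (k c : nat) (b : bool) :
  uniq t -> {subset t <= s} -> c \in s -> c \notin t ->
  P (X c @^-1` [set b] `&` top_count t k) =
  (binomial_weight (size t) k * (if b then p else 1 - p))%:E.
Proof.
move=> uniq_t sub_ts cs ct.
pose B c' := if c' == c then [set b] else setT.
have BT : {in t, forall c', B c' = setT}.
  by move=> c' c't; rewrite /B; case: eqP => // cc'; rewrite -cc' c't in ct.
have := @prob_top_count_bigcap t B k uniq_t sub_ts BT.
rewrite (bigD1_seq c) ?mem_undup ?undup_uniq //= big1; last first.
  by move=> c' /negbTE c'c; rewrite /B c'c preimage_setT probability_setT.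
rewrite mule1 /B eqxx prob_placement // -EFinM => <-; rewrite setIC; congr (P (_ `&` _)).
apply/seteqP; split=> w /=.
  by move=> Xcw c' _ /=; case: eqP => // ->.
by move=> /(_ c cs) /=; rewrite eqxx.
Qed.

End PlacementCounts.

Theorem proposition2 (R : realType) (d : measure_display)
    (T : measurableType d) (P : probability T R) (p : R) (n : nat)
    (X : nat -> {RV P >-> bool})
    (hp : 0 < p < 1) (hX : shelf_placements p n X) :
  (forall i j : nat, (1 <= i <= n - 1)%N -> (1 <= j <= n)%N ->
    landing_prob n X i j =
    (p ^+ j * (1 - p) ^ (i%:Z - j%:Z) * 'C(i - 1, j - 1)%:R +
     p ^ (i%:Z - 1 - (n%:Z - j%:Z)) * (1 - p) ^+ (n - j + 1)
       * 'C(i - 1, n - j)%:R)%:E) /\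
  (forall j : nat, (1 <= j <= n)%N ->
    landing_prob n X n j =
    (p ^+ (j - 1) * (1 - p) ^+ (n - j) * 'C(n - 1, j - 1)%:R)%:E).
Proof.
case: hX => indep law.
have sub_deck i : (i <= n)%N -> {subset iota 1 (i - 1) <= ordered_deck n}.
  by move=> le_in c; rewrite !mem_iota; lia.
split=> [i j hi hj|j hj]; rewrite /landing_prob.
- have le_in : (i <= n)%N by lia.
  have i_deck : i \in ordered_deck n by rewrite mem_iota; lia.
  have iNsmaller : i \notin iota 1 (i - 1) by rewrite mem_iota; lia.
  (* Entering at the top, card [i] needs [j - 1] later top placements; entering at the bottom, it
     needs [j - 1 - (n - i) = i - 1 - (n - j)]. The guard excludes the case where this difference is
     negative and would be truncated to 0. *)
  have -> : [set w | position i (shelf_shuffle n (fun c => X c w)) = j] =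
      (X i @^-1` [set true] `&` top_count X (iota 1 (i - 1)) (j - 1)) `|`
      (if (n - i <= j - 1)%N then
         X i @^-1` [set false] `&`
         top_count X (iota 1 (i - 1)) (i - 1 - (n - j)) else set0).
    apply/seteqP; split=> w; rewrite /= /top_count position_shelf_shuffle ?le_in //=; try lia.
      case Xiw: (X i w) => eq_j; [left; split=> //; lia | right].
      by rewrite ifT; [split=> //=; lia | lia].
    case=> [[-> eq_j]|]; first lia.
    by case: ifP => // le_nij [-> /= eq_j]; lia.
  have weight_top : binomial_weight p (i - 1) (j - 1) * p =
      p ^+ j * (1 - p) ^ (i%:Z - j%:Z) * 'C(i - 1, j - 1)%:R.
    (* A negative exponent [i - j] occurs only for [j > i], where the binomial coefficient is 0. *)
    rewrite /binomial_weight; case: (leqP j i) => [le_ji|lt_ij].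
      rewrite (_ : i%:Z - j%:Z = (i - 1 - (j - 1))%N%:Z); last lia.
      rewrite -exprnP (_ : p ^+ j = p ^+ (j - 1) * p); first ring.
      by rewrite -exprSr subn1 prednK //; lia.
    by rewrite bin_small ?mulr0 ?mul0r //; lia.
  (* If [j - 1 < n - i], a bottom entry is already too low; correspondingly [n - j > i - 1] makes
     the second term vanish. *)
  case: ifP => [le_nij|gt_nij]; last first.
    rewrite setU0 (prob_top_count_placement indep law) ?iota_uniq ?size_iota //; last exact: sub_deck.
    by rewrite weight_top (@bin_small (i - 1) (n - j)) ?mulr0 ?addr0 //; lia.
  have weight_bottom : binomial_weight p (i - 1) (i - 1 - (n - j)) * (1 - p) =
      p ^ (i%:Z - 1 - (n%:Z - j%:Z)) * (1 - p) ^+ (n - j + 1)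
        * 'C(i - 1, n - j)%:R.
    (* Symmetry of binomial coefficients turns the count [i - 1 - (n - j)] of top placements into
       the count [n - j] of bottom ones. *)
    rewrite /binomial_weight bin_sub ?subKn; try lia.
    rewrite (_ : i%:Z - 1 - (n%:Z - j%:Z) = (i - 1 - (n - j))%N%:Z); last lia.
    by rewrite -exprnP addn1 exprSr; ring.
  rewrite measureU.
  + rewrite -weight_top -weight_bottom EFinD.
    have placement b k :=
      @prob_top_count_placement _ _ _ _ _ _ _ indep law _ k i b
        (iota_uniq 1 (i - 1)) (sub_deck i le_in) i_deck iNsmaller.
    by congr adde; apply: etrans (placement _ _) _; rewrite size_iota.
  + by apply: measurableI; [exact: measurable_placement|exact: measurable_top_count].
  + by apply: measurableI; [exact: measurable_placement|exact: measurable_top_count].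
  + by apply/seteqP; split=> w //= -[[-> _] []].
(* Card [n] enters an empty pile, so only the [n - 1] later placements decide its position. *)
- rewrite (_ : [set w | _] = top_count X (iota 1 (n - 1)) (j - 1)).
    rewrite (prob_top_count indep law) ?iota_uniq ?size_iota //.
      by rewrite /binomial_weight (_ : (n - 1 - (j - 1))%N = (n - j)%N) //; lia.
    exact: sub_deck.
  apply/seteqP; split=> w; rewrite /= /top_count /= position_shelf_shuffle ?subnn ?if_same; lia.
Qed.
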